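(* Let $S(P_n)$ be the splitting graph of the path $P_n$ on $n$ vertices. Then for $2\leq n\leq 4$, $F_d[S(P_n)]=n$.
   Context: The splitting graph $S(G)$ of a graph $G$ is obtained from $G$ by adding, for each vertex $v$ of $G$, a new vertex $v'$ and joining $v'$ to all vertices of $G$ adjacent to $v$ in $G$ (the new vertices are pairwise nonadjacent). Zero forcing: given a set $B\subseteq V(G)$ of initially black vertices (all others white) of a finite simple graph $G$, at each step a black vertex having exactly one white neighbor forces that neighbor to become black; $B$ is a zero forcing set of $G$ if repeated application of this rule turns all vertices black. A set $D\subseteq V(G)$ is dominating if every vertex of $G$ is in $D$ or adjacent to a vertex of $D$. A dom-forcing set of $G$ is a set $D_f\subseteq V(G)$ that is both a dominating set of $G$ and a zero forcing set of $G$; the dom-forcing number $F_d(G)$ is the minimum cardinality of a dom-forcing set. *)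

(* Defs.v *)
From mathcomp Require Import all_boot.

Set Implicit Arguments.
Unset Strict Implicit.
Unset Printing Implicit Defensive.

Record sgraph := SGraph {
  vertex :> finType;
  adj : rel vertex;
  adj_sym : symmetric adj;
  adj_irrefl : irreflexive adj }.

Definition neighbors (G : sgraph) (u : G) : {set G} := [set v | adj u v].

Section Path.
Variable n : nat.

Definition path_adj : rel 'I_n :=
  fun i j => (i.+1 == j) || (j.+1 == i).

Lemma path_adj_sym : symmetric path_adj.
Proof. by move=> i j; rewrite /path_adj orbC. Qed.

Lemma path_adj_irrefl : irreflexive path_adj.
Proof. by move=> i; rewrite /path_adj orbb gtn_eqF. Qed.

Definition path_graph : sgraph := SGraph path_adj_sym path_adj_irrefl.

End Path.

Section Splitting.
Variable G : sgraph.

(* [inl v] is the original vertex v and [inr v] is its copy v'. *)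
Definition splitting_adj : rel (G + G) := fun x y =>
  match x, y with
  | inl u, inl v => adj u v
  | inl u, inr v => adj u v
  | inr u, inl v => adj u v
  | inr _, inr _ => false
  end.

Lemma splitting_adj_sym : symmetric splitting_adj.
Proof. by move=> [u|u] [v|v] //=; rewrite adj_sym. Qed.

Lemma splitting_adj_irrefl : irreflexive splitting_adj.
Proof. by move=> [u|u] //=; rewrite adj_irrefl. Qed.

Definition splitting_graph : sgraph :=
  SGraph splitting_adj_sym splitting_adj_irrefl.

End Splitting.

Section DomForcing.
Variable G : sgraph.
Implicit Types B C D : {set G}.

(* C is obtained from the black set B by a single force: some black vertex u
   has exactly one white neighbor v, and v becomes black. *)
Definition force_step : rel {set G} := fun B C =>
  [exists u in B, exists v,
    (neighbors u :\: B == [set v]) && (C == v |: B)].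

Definition zero_forcing B : bool := connect force_step B [set: G].

Definition dominating D : bool :=
  [forall v, (v \in D) || [exists u in D, adj u v]].

Definition dom_forcing D : bool := dominating D && zero_forcing D.

Lemma dom_forcing_setT : dom_forcing [set: G].
Proof.
rewrite /dom_forcing /zero_forcing connect0 andbT.
by apply/forallP => v; rewrite in_setT.
Qed.

(* The default value [set: G] of the arg min is itself dom-forcing, so this is
   the minimum cardinality; see [dom_forcing_numberP]. *)
Definition dom_forcing_number : nat :=
  #|[arg min_(D < [set: G] | dom_forcing D) #|D|]|.

Lemma dom_forcing_numberP :
  (exists2 D, dom_forcing D & #|D| = dom_forcing_number) /\
  (forall D, dom_forcing D -> dom_forcing_number <= #|D|).
Proof.
rewrite /dom_forcing_number; case: arg_minnP; first exact: dom_forcing_setT.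
by move=> D domD minD; split=> //; exists D.
Qed.

End DomForcing.

(* Main.v *)
(** The upper bounds are explicit dom-forcing sets.  For the lower bounds, a
    dominating set meets every closed neighbourhood, and a zero forcing set
    meets every fort, i.e. every nonempty F such that no vertex outside F has
    exactly one neighbour in F: while F is white, no vertex of F can be forced.
    In each of the three graphs, every set that meets all closed neighbourhoods
    and a few well-chosen forts has at least n elements. *)
Require Import Defs.
From mathcomp Require Import all_boot.

(** Over an explicit list of vertices the cardinality becomes a sum of membership bits, so a lower
    bound reduces to a finite Boolean case split. *)
Lemma card_count_mem (T : finType) (s : seq T) (D : {set T}) :
  uniq s -> (forall x, x \in s) -> #|D| = count (mem D) s.
Proof.
move=> s_uniq s_full; rewrite cardE -size_filter; apply: perm_size.
apply: uniq_perm; rewrite ?enum_uniq ?filter_uniq // => x.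
by rewrite mem_enum mem_filter s_full andbT.
Qed.

Lemma dom_forcing_number_eq (G : sgraph) (k : nat) :
  (exists2 D : {set G}, dom_forcing D & #|D| <= k) ->
  (forall D : {set G}, dom_forcing D -> k <= #|D|) ->
  dom_forcing_number G = k.
Proof.
move=> [D domD leDk] lower; have [[M domM eqM] minM] := dom_forcing_numberP G.
by apply/eqP; rewrite eqn_leq (leq_trans (minM D domD)) // -eqM lower.
Qed.

Lemma dom_forcing_zero_forcing {G : sgraph} {D : {set G}} :
  dom_forcing D -> zero_forcing D.
Proof. by case/andP. Qed.

Lemma dom_forcing_meets_nbhd (G : sgraph) (D : {set G}) (v : G) (s : seq G) :
  (forall u, adj u v -> u \in s) -> dom_forcing D -> has (mem D) (v :: s).
Proof.
move=> nbhd_s /andP[/forallP/(_ v) + _] => /= /orP[-> //|].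
by case/exists_inP=> u uD /nbhd_s us; apply/orP; right; apply/hasP; exists u.
Qed.

(** Having not exactly one neighbour in [F] is phrased as: each neighbour in [F] comes with a second
    one. Over a list this evaluates by computation. *)
Definition fort_at {G : sgraph} (F : seq G) (u : G) : bool :=
  (u \in F) ||
  all (fun w => adj u w ==> has (fun w' => adj u w' && (w' != w)) F) F.

(** Induction on the forcing chain: if [F] is first met by the forced [v], then the forcing vertex
    [u] is black and either lies in [F] or has a second neighbour in [F], already black since [v]
    was its only white one. *)
Lemma zero_forcing_meets_fort (G : sgraph) (F : seq G) (D : {set G}) :
  F != [::] -> (forall u, fort_at F u) -> zero_forcing D -> has (mem D) F.
Proof.
move=> F_neq0 fortF /connectP[p]; elim: p D => [|C p IHp] D /=.
  by move=> _ <-; case: F F_neq0 {fortF} => // x F _; rewrite /= in_setT.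
case/andP=> /exists_inP[u uD /existsP[v /andP[/eqP whiteE /eqP defC]]] pathC lastC.
case/hasP: (IHp C pathC lastC) => x xF; rewrite /= defC !inE => /orP[|xD]; last first.
  by apply/hasP; exists x.
move=> /eqP x_v; subst x; apply/hasP.
have uv : adj u v by have := set11 v; rewrite -whiteE !inE => /andP[].
case/orP: (fortF u) => [uF | /allP/(_ v xF)]; first by exists u.
rewrite uv => /hasP[w wF /andP[uw w_neq_v]]; exists w => //=.
apply: contraNT w_neq_v => wD.
by rewrite -in_set1 -whiteE !inE wD uw.
Qed.

Lemma zero_forcing_full (G : sgraph) (s : seq G) :
  (forall v, v \in s) -> zero_forcing [set x in s].
Proof.
move=> s_full; rewrite /zero_forcing.
by have -> : [set x in s] = [set: G] by apply/setP=> x; rewrite !inE s_full.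
Qed.

(** Allowing [v] to be in [s] already spares a whiteness check; the force is then vacuous. *)
Lemma zero_forcing_force (G : sgraph) (u v : G) (s : seq G) :
  u \in s -> adj u v -> (forall w, adj u w ==> (w \in v :: s)) ->
  zero_forcing [set x in v :: s] -> zero_forcing [set x in s].
Proof.
move=> us uv u_nbrs; rewrite /zero_forcing set_cons.
have [v_s | v_notin_s] := boolP (v \in s).
  by rewrite (setUidPr _) // sub1set inE.
apply/connect_trans/connect1/exists_inP; exists u; rewrite ?inE //.
apply/existsP; exists v; rewrite eqxx andbT; apply/eqP/setP=> w.
rewrite !inE; have [-> | w_neq_v] := eqVneq w v; first by rewrite v_notin_s uv.
have := u_nbrs w; rewrite inE (negPf w_neq_v) /=.
by case: (adj u w); case: (w \in s).
Qed.

Lemma dom_forcing_mem (G : sgraph) (s : seq G) :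
  (forall v, (v \in s) || has (fun u => adj u v) s) ->
  zero_forcing [set x in s] -> dom_forcing [set x in s].
Proof.
move=> dom_s zf_s; rewrite /dom_forcing zf_s andbT; apply/forallP=> v.
rewrite inE; case/orP: (dom_s v) => [-> // | /hasP[u us uv]].
by apply/orP; right; apply/exists_inP; exists u; rewrite ?inE.
Qed.

Notation SP n := (splitting_graph (path_graph n)).
(* [L n i] is the i-th vertex of the path, counted from 0, and [R n i] its copy. *)
Notation L n i := (inl (@Ordinal n i isT) : SP n).
Notation R n i := (inr (@Ordinal n i isT) : SP n).

Ltac each_vertex := by case=> [] [] [|[|[|[|?]]]] ?.

Lemma SP2_upper : exists2 D : {set SP 2}, dom_forcing D & #|D| <= 2.
Proof.
exists [set x in [:: L 2 0; L 2 1]]; last first.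
  by rewrite cardsE (leq_trans (card_size _)).
apply: dom_forcing_mem; first each_vertex.
apply: (@zero_forcing_force _ (L 2 0) (R 2 1)) => //; first each_vertex.
apply: (@zero_forcing_force _ (L 2 1) (R 2 0)) => //; first each_vertex.
apply: zero_forcing_full; each_vertex.
Qed.

Lemma SP3_upper : exists2 D : {set SP 3}, dom_forcing D & #|D| <= 3.
Proof.
exists [set x in [:: L 3 0; L 3 1; R 3 0]]; last first.
  by rewrite cardsE (leq_trans (card_size _)).
apply: dom_forcing_mem; first each_vertex.
apply: (@zero_forcing_force _ (L 3 0) (R 3 1)) => //; first each_vertex.
apply: (@zero_forcing_force _ (R 3 1) (L 3 2)) => //; first each_vertex.
apply: (@zero_forcing_force _ (L 3 1) (R 3 2)) => //; first each_vertex.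
apply: zero_forcing_full; each_vertex.
Qed.

Lemma SP4_upper : exists2 D : {set SP 4}, dom_forcing D & #|D| <= 4.
Proof.
exists [set x in [:: L 4 0; L 4 1; L 4 2; L 4 3]]; last first.
  by rewrite cardsE (leq_trans (card_size _)).
apply: dom_forcing_mem; first each_vertex.
apply: (@zero_forcing_force _ (L 4 0) (R 4 1)) => //; first each_vertex.
apply: (@zero_forcing_force _ (L 4 2) (R 4 3)) => //; first each_vertex.
apply: (@zero_forcing_force _ (L 4 3) (R 4 2)) => //; first each_vertex.
apply: (@zero_forcing_force _ (L 4 1) (R 4 0)) => //; first each_vertex.
apply: zero_forcing_full; each_vertex.
Qed.

Ltac nbhd D domD v s :=
  have := @dom_forcing_meets_nbhd _ D v s ltac:(each_vertex) domD.

Ltac fort D domD F :=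
  have := @zero_forcing_meets_fort _ F D isT ltac:(each_vertex)
            (dom_forcing_zero_forcing domD).

Lemma SP2_lower (D : {set SP 2}) : dom_forcing D -> 2 <= #|D|.
Proof.
move=> domD; rewrite (@card_count_mem _ [:: L 2 0; L 2 1; R 2 0; R 2 1]) //;
  last each_vertex.
nbhd D domD (R 2 0) [:: L 2 1].
nbhd D domD (R 2 1) [:: L 2 0].
move=> /=; by do 4! case: (_ \in D).
Qed.

(** The two ends are twins, and so are their copies; each twin pair is a fort. *)
Lemma SP3_lower (D : {set SP 3}) : dom_forcing D -> 3 <= #|D|.
Proof.
move=> domD; rewrite (@card_count_mem _ [:: L 3 0; L 3 1; L 3 2; R 3 0; R 3 1; R 3 2]) //;
  last each_vertex.
nbhd D domD (R 3 0) [:: L 3 1].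
nbhd D domD (R 3 2) [:: L 3 1].
fort D domD [:: L 3 0; L 3 2].
fort D domD [:: R 3 0; R 3 2].
move=> /=; by do 6! case: (_ \in D).
Qed.

(** The closed neighbourhoods of [R 4 0] and [R 4 3] and the first fort partition the vertices, so
    three elements would mean one in each. Whichever are chosen in the two neighbourhoods, the other
    conditions require an element of both [{L 4 0, R 4 1}] and [{L 4 3, R 4 2}], the two halves of
    that fort. *)
Lemma SP4_lower (D : {set SP 4}) : dom_forcing D -> 4 <= #|D|.
Proof.
move=> domD.
rewrite (@card_count_mem _ [:: L 4 0; L 4 1; L 4 2; L 4 3; R 4 0; R 4 1; R 4 2; R 4 3]) //;
  last each_vertex.
nbhd D domD (L 4 0) [:: L 4 1; R 4 1].
nbhd D domD (L 4 3) [:: L 4 2; R 4 2].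
nbhd D domD (R 4 0) [:: L 4 1].
nbhd D domD (R 4 1) [:: L 4 0; L 4 2].
nbhd D domD (R 4 2) [:: L 4 1; L 4 3].
nbhd D domD (R 4 3) [:: L 4 2].
fort D domD [:: L 4 0; L 4 3; R 4 1; R 4 2].
fort D domD [:: L 4 0; R 4 0; R 4 1; R 4 3].
fort D domD [:: L 4 3; R 4 0; R 4 2; R 4 3].
move=> /=; by do 8! case: (_ \in D).
Qed.

Theorem theorem5p5 (n : nat) (hn : 2 <= n <= 4) :
  dom_forcing_number (splitting_graph (path_graph n)) = n.
Proof.
case: n hn => [|[|[|[|[|n]]]]] // _; apply: dom_forcing_number_eq.
- exact: SP2_upper.
- exact: SP2_lower.
- exact: SP3_upper.
- exact: SP3_lower.
- exact: SP4_upper.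
- exact: SP4_lower.
Qed.
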